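(* Let $m\ge3$ and let $Y_1,\dots,Y_m\in\mathbb{R}^{2n\times n}$ be frames. (i) For any $2\le l<m$, $$\nu_c^{\pm}(Y_1,\dots,Y_m)=\nu_c^{\pm}(Y_1,\dots,Y_l)+\nu_c^{\pm}(Y_1,Y_l,\dots,Y_m)=\nu_c^{\pm}(Y_1,\dots,Y_l,Y_m)+\nu_c^{\pm}(Y_l,\dots,Y_m),$$ where $\nu_c^{\pm}(Y_i,Y_j)=0$, and $$\nu_c^{\pm}(Y_1,\dots,Y_m)=\sum_{j=2}^{m-1}\nu_c^{\pm}(Y_1,Y_j,Y_{j+1})=\sum_{j=1}^{m-2}\nu_c^{\pm}(Y_j,Y_{j+1},Y_m).$$ (ii) For any $2\le l<m$, $$\mu_c^{\pm}(Y_1,\dots,Y_m)=\mu_c^{\pm}(Y_1,\dots,Y_l)+\mu_c^{\pm}(Y_1,Y_l,\dots,Y_m)-\operatorname{rank}w(Y_1,Y_l)=\mu_c^{\pm}(Y_1,\dots,Y_l,Y_m)+\mu_c^{\pm}(Y_l,\dots,Y_m)-\operatorname{rank}w(Y_l,Y_m),$$ where $\mu_c^{\pm}(Y_i,Y_j)=\operatorname{rank}w(Y_i,Y_j)$, and $$\mu_c^{\pm}(Y_1,\dots,Y_m)=\sum_{j=2}^{m-1}\mu_c^{\pm}(Y_1,Y_j,Y_{j+1})-\sum_{j=3}^{m-1}\operatorname{rank}w(Y_1,Y_j)=\sum_{j=1}^{m-2}\mu_c^{\pm}(Y_j,Y_{j+1},Y_m)-\sum_{j=2}^{m-2}\ope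ratorname{rank}w(Y_j,Y_m).$$
   Context: $\mathcal{J}=\begin{pmatrix}0&I\\-I&0\end{pmatrix}\in\mathbb{R}^{2n\times 2n}$ and $w(Y,\hat Y)=Y^T\mathcal{J}\hat Y$. For a real symmetric matrix $A$, $\operatorname{ind}A$ is the number of negative eigenvalues counted with multiplicity. $A^{\dagger}$ is the Moore–Penrose pseudoinverse. Empty sums are $0$. A frame is a real $2n\times n$ matrix $Y$ with $w(Y,Y)=0$ and $\operatorname{rank}Y=n$. For frames $Y=\binom{X}{U}$, $\hat Y=\binom{\hat X}{\hat U}$ ($n\times n$ blocks) put $\mathcal M=(I-X^{\dagger}X)\,w(Y,\hat Y)$, $\mathcal T=I-\mathcal M^{\dagger}\mathcal M$, $\mathcal P=\mathcal T\,w(Y,\hat Y)^T X^{\dagger}\hat X\,\mathcal T$ (symmetric), and define the comparative index and dual comparative index $\mu(Y,\hat Y)=\operatorname{rank}\mathcal M+\operatorname{ind}\mathcal P$, $\mu^*(Y,\hat Y)=\operatorname{rank}\mathcal M+\operatorname{ind}(-\mathcal P)$. Cyclic sums, for any number $m\ge2$ of frames: $\mu_c^-(Y_1,\dots,Y_m)=\sum_{k=1}^{m-1}\mu(Y_k,Y_{k+1})+\mu(Y_m,Y_1)$, $\mu_c^+(Y_1,\dots,Y_m)=\sum_{k=1}^{m-1}\mu^*(Y_k,Y_{k+1})+\mu^*(Y_m,Y_1)$, $\nu_c^-(Y_1,\dots,Y_m)=\sum_{k=1}^{m-1}\mu(Y_k,Y_{k+1})-\mu(Y_1,Y_m)$,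 $\nu_c^+(Y_1,\dots,Y_m)=\sum_{k=1}^{m-1}\mu^*(Y_k,Y_{k+1})-\mu^*(Y_1,Y_m)$. *)

(* Defs.v *)
From mathcomp Require Import all_boot all_order all_algebra.
From mathcomp Require Import polyrcf reals.

Set Implicit Arguments.
Unset Strict Implicit.
Unset Printing Implicit Defensive.

Import Order.TTheory GRing.Theory Num.Theory.
Local Open Scope ring_scope.

Section Pseudoinverse.
Variable R : realFieldType.

(* The four Penrose conditions: B is the Moore-Penrose pseudoinverse of A. *)
Definition penrose m n (A : 'M[R]_(m, n)) (B : 'M[R]_(n, m)) : bool :=
  [&& A *m B *m A == A, B *m A *m B == B,
      (A *m B)^T == A *m B & (B *m A)^T == B *m A].

Lemma gram_unitmx m n (B : 'M[R]_(m, n)) : row_free B -> B *m B^T \in unitmx.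
Proof.
move=> fB; rewrite -row_free_unit; apply: inj_row_free => v vBB0.
have vB0 : v *m B = 0.
  have: (v *m B *m (v *m B)^T) 0 0 = 0.
    by rewrite trmx_mul !mulmxA -(mulmxA v) vBB0 mul0mx mxE.
  rewrite mxE => /eqP; rewrite psumr_eq0; last first.
    by move=> i _; rewrite [_^T _ _]mxE -expr2 sqr_ge0.
  move=> /allP vB2; apply/rowP => j; rewrite [RHS]mxE.
  have := vB2 j (mem_index_enum _).
  by rewrite [_^T _ _]mxE -expr2 sqrf_eq0 => /eqP.
by apply: (row_free_inj fB); rewrite vB0 mul0mx.
Qed.

Lemma penrose_exists m n (A : 'M[R]_(m, n)) : exists B, penrose A B.
Proof.
have := row_base_free A; have := col_base_full A; have := mulmx_base A.
move: (\rank A) (col_base A) (row_base A) => r C F defA fullC freeF.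
have uF : F *m F^T \in unitmx by exact: gram_unitmx.
have uC : C^T *m C \in unitmx.
  by rewrite -{2}[C]trmxK; apply: gram_unitmx; rewrite /row_free mxrank_tr.
pose G := invmx (F *m F^T); pose H := invmx (C^T *m C).
have FG : F *m F^T *m G = 1%:M by rewrite mulmxV.
have HC : H *m (C^T *m C) = 1%:M by rewrite mulVmx.
have GT : G^T = G by rewrite trmx_inv trmx_mul trmxK.
have HT : H^T = H by rewrite trmx_inv trmx_mul trmxK.
pose B := F^T *m G *m (H *m C^T).
have AB : A *m B = C *m H *m C^T.
  rewrite -defA /B !mulmxA -(mulmxA C F) -(mulmxA C (F *m F^T)) FG.
  by rewrite mulmx1.
have BA : B *m A = F^T *m G *m F.
  rewrite -defA /B !mulmxA -(mulmxA _ C^T C) -(mulmxA _ H) HC.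
  by rewrite mulmx1.
exists B; rewrite /penrose AB BA; apply/and4P; split; apply/eqP.
- by rewrite -defA !mulmxA -(mulmxA _ C^T C) -(mulmxA C H) HC mulmx1.
- rewrite /B !mulmxA -(mulmxA _ F F^T) -(mulmxA _ (F *m F^T) G) FG.
  by rewrite mulmx1.
- by rewrite !trmx_mul trmxK HT mulmxA.
- by rewrite !trmx_mul trmxK GT mulmxA.
Qed.

Lemma penrose_inj m n (A : 'M[R]_(m, n)) (B B' : 'M[R]_(n, m)) :
  penrose A B -> penrose A B' -> B = B'.
Proof.
move=> /and4P[/eqP a1 /eqP a2 /eqP a3 /eqP a4].
move=> /and4P[/eqP b1 /eqP b2 /eqP b3 /eqP b4].
have eqAB : A *m B = A *m B'.
  rewrite -[LHS]a3 -{1}b1 -!mulmxA [in LHS]mulmxA trmx_mul a3 b3.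
  by rewrite mulmxA a1.
have eqBA : B *m A = B' *m A.
  rewrite -[LHS]a4 -{1}b1 -mulmxA mulmxA trmx_mul b4 a4.
  by rewrite -!mulmxA (mulmxA A B) a1.
by rewrite -a2 eqBA -mulmxA eqAB mulmxA b2.
Qed.

Definition mpinv m n (A : 'M[R]_(m, n)) : 'M[R]_(n, m) :=
  xchoose (penrose_exists A).

Lemma mpinvP m n (A : 'M[R]_(m, n)) : penrose A (mpinv A).
Proof. exact: xchooseP. Qed.

End Pseudoinverse.

(* Number of negative eigenvalues, counted with algebraic multiplicity; rootsR
   lists each real root once.  Meaningful for symmetric A, whose eigenvalues
   are all real. *)
Definition ind (R : rcfType) n (A : 'M[R]_n) : nat :=
  (\sum_(x <- rootsR (char_poly A) | (x < 0)%R) mup x (char_poly A))%N.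

Section ComparativeIndex.
Variables (R : realType) (n : nat).

Definition sympJ : 'M[R]_(n + n) := block_mx 0 1%:M (- 1%:M) 0.

Definition wronskian (Y Yh : 'M[R]_(n + n, n)) : 'M[R]_n :=
  Y^T *m sympJ *m Yh.

Definition frame (Y : 'M[R]_(n + n, n)) : Prop :=
  wronskian Y Y = 0 /\ \rank Y = n.

(* For Y = (X ; U), the blocks are X = usubmx Y and U = dsubmx Y. *)
Definition ciM (Y Yh : 'M[R]_(n + n, n)) : 'M[R]_n :=
  (1%:M - mpinv (usubmx Y) *m usubmx Y) *m wronskian Y Yh.

Definition ciT (Y Yh : 'M[R]_(n + n, n)) : 'M[R]_n :=
  1%:M - mpinv (ciM Y Yh) *m ciM Y Yh.

Definition ciP (Y Yh : 'M[R]_(n + n, n)) : 'M[R]_n :=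
  ciT Y Yh *m (wronskian Y Yh)^T *m mpinv (usubmx Y) *m usubmx Yh *m ciT Y Yh.

Definition mu (Y Yh : 'M[R]_(n + n, n)) : nat :=
  (\rank (ciM Y Yh) + ind (ciP Y Yh))%N.

Definition mu_star (Y Yh : 'M[R]_(n + n, n)) : nat :=
  (\rank (ciM Y Yh) + ind (- ciP Y Yh))%N.

End ComparativeIndex.

Inductive csign := Cminus | Cplus.

Section CyclicSums.
Variables (R : realType) (n : nat).

(* The superscript - goes with mu, and + with mu_star. *)
Definition mu_sgn (e : csign) : 'M[R]_(n + n, n) -> 'M[R]_(n + n, n) -> nat :=
  match e with Cminus => @mu R n | Cplus => @mu_star R n end.

(* The frames Y_1, ..., Y_m are the entries s`_0, ..., s`_m.-1 of s, so
   m = size s; only m >= 2 is meaningful. *)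
Definition mu_c (e : csign) (s : seq 'M[R]_(n + n, n)) : int :=
  \sum_(0 <= k < (size s).-1) (mu_sgn e s`_k s`_k.+1)%:Z
  + (mu_sgn e s`_(size s).-1 s`_0)%:Z.

Definition nu_c (e : csign) (s : seq 'M[R]_(n + n, n)) : int :=
  \sum_(0 <= k < (size s).-1) (mu_sgn e s`_k s`_k.+1)%:Z
  - (mu_sgn e s`_0 s`_(size s).-1)%:Z.

End CyclicSums.

(* The inclusive list Y_a, Y_(a+1), ..., Y_b. *)
Definition segment (T : Type) (Y : nat -> T) (a b : nat) : seq T :=
  [seq Y k | k <- index_iota a b.+1].

(* Main.v *)
Require Import Defs.
From HB Require Import structures.
From mathcomp Require Import all_boot all_order all_algebra.
From mathcomp Require Import reals polyrcf complex ring.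

(** Part (i) is telescoping.  Part (ii) reduces by telescoping to the identity
    mu(Y,Z) + mu(Z,Y) = rank w(Y,Z), and likewise for mu^*.  For frames Y and Z
    with upper blocks X and X', the matrix P(Y,Z) represents in ker M(Y,Z) a
    quadratic form that depends only on the vectors of Im X :&: Im X', and
    exchanging Y and Z changes its sign.  Hence P(Y,Z) and -P(Z,Y) are
    congruent, so by Sylvester's law of inertia the two indices add up to
    rank P(Y,Z); splitting off the kernels of M(Y,Z) and M(Z,Y) gives
    rank w(Y,Z) = rank M(Y,Z) + rank M(Z,Y) + rank P(Y,Z). *)

Set Implicit Arguments.
Unset Strict Implicit.
Unset Printing Implicit Defensive.

Import Order.TTheory GRing.Theory Num.Theory.
Local Open Scope ring_scope.

(** * Negative eigenvalues from a split characteristic polynomial *)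

Lemma tr_congr (R : comNzRingType) m n (A : 'M[R]_n) (S : 'M[R]_(n, m)) :
  A^T = A -> (S^T *m A *m S)^T = S^T *m A *m S.
Proof. by move=> sA; rewrite 2!trmx_mul trmxK sA mulmxA. Qed.

Lemma mup_prod_XsubC (F : fieldType) (n : nat) (d : 'I_n -> F) (x : F) :
  mup x (\prod_(i < n) ('X - (d i)%:P)) = (\sum_(i < n) (d i == x))%N.
Proof.
elim: n d => [|n IH] d; first by rewrite !big_ord0 mupNroot ?root1.
rewrite !big_ord_recl mupM ?polyXsubC_eq0 //; last first.
  by apply/prodf_neq0 => i _; rewrite polyXsubC_eq0.
rewrite IH; congr addn.
by rewrite -[X in mup x X]expr1 mup_XsubCX; case: eqP.
Qed.

(** Once the sums over roots and over [i] are exchanged, [d i] is a root that [rootsR] lists exactly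
    once, so [i] counts once if [d i] is negative and not at all otherwise. *)
Lemma ind_prod_XsubC (R : rcfType) (n : nat) (A : 'M[R]_n) (d : 'I_n -> R) :
  char_poly A = \prod_(i < n) ('X - (d i)%:P) ->
  ind A = (\sum_(i < n) (d i < 0)%R)%N.
Proof.
move=> Ad; rewrite /ind; under eq_bigr do rewrite Ad mup_prod_XsubC.
rewrite exchange_big /=; apply: eq_bigr => i _.
have A0 : char_poly A != 0 by rewrite monic_neq0 ?char_poly_monic.
have di : d i \in rootsR (char_poly A).
  rewrite -[_ \in _](roots_on_rootsR A0) /= Ad rootE horner_prod.
  by rewrite (bigD1 i) //= hornerXsubC subrr mul0r.
rewrite big_mkcond (bigD1_seq (d i)) ?uniq_roots //= eqxx big1 => [|x].
  by rewrite addn0; case: ifP.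
by rewrite eq_sym => /negPf ->; case: ifP.
Qed.

Lemma char_poly_conj (F : fieldType) n (P D : 'M[F]_n) :
  P \in unitmx -> char_poly (invmx P *m D *m P) = char_poly D.
Proof.
move=> uP; pose Q := map_mx (@polyC F) P.
have QV : map_mx (@polyC F) (invmx P) *m Q = 1%:M.
  by rewrite -map_mxM mulVmx // map_mx1.
rewrite /char_poly; have -> : char_poly_mx (invmx P *m D *m P)
    = map_mx (@polyC F) (invmx P) *m char_poly_mx D *m Q.
  rewrite /char_poly_mx !map_mxM mulmxBr mulmxBl; congr (_ - _).
  by rewrite scalar_mxC -mulmxA QV mulmx1.
rewrite !det_mulmx mulrAC -det_mulmx QV det1 mul1r //.
Qed.

(** * Spectral theorem and Sylvester's law of inertia *)

Section Inertia.
Local Open Scope sesquilinear_scope.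
Variable R : rcfType.
Local Notation toC := (real_complex R).

(** Diagonalization takes place over [R[i]], but [d] stays over [R] so that its signs can be
    counted. *)
Definition spectral_decomp n (A : 'M[R]_n) (P : 'M[R[i]]_n) (d : 'rV[R]_n) :=
  P \is unitarymx /\ map_mx toC A = P^t* *m diag_mx (map_mx toC d) *m P.

Lemma conj_toC m n (A : 'M[R]_(m, n)) : (map_mx toC A)^t* = map_mx toC A^T.
Proof. by apply/matrixP => i j; rewrite !mxE; exact: conjc_real. Qed.

Lemma symmetric_spectral n (A : 'M[R]_n) :
  A^T = A -> exists P d, spectral_decomp A P d.
Proof.
move=> sA; pose B := map_mx toC A.
have hB : B \is hermsymmx.
  by apply/is_hermitianmxP; rewrite expr0 scale1r conj_toC sA.
have := orthomx_spectralP (hermitian_normalmx hB).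
rewrite invmx_unitary ?spectral_unitarymx // => eB.
(* The spectrum of a Hermitian matrix is real, so taking real parts loses nothing. *)
exists (spectralmx B), (map_mx (@complex.Re R) (spectral_diag B)).
split; first exact: spectral_unitarymx.
rewrite -map_mx_comp -/B {1}eB; congr (_ *m diag_mx _ *m _).
apply/rowP => i; rewrite [RHS]mxE /= RRe_real //.
exact/mxOverP/hermitian_spectral_diag_real.
Qed.

Lemma ind_spectral n (A : 'M[R]_n) P d :
  spectral_decomp A P d -> ind A = (\sum_(i < n) (d 0 i < 0)%R)%N.
Proof.
case=> uP eA; apply: ind_prod_XsubC; apply: (@map_poly_inj _ _ toC).
rewrite map_char_poly eA -invmx_unitary // char_poly_conj ?unitarymx_unit //.
rewrite char_poly_trig ?diag_mx_is_trig // rmorph_prod.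
apply: eq_bigr => i _; rewrite rmorphB /= map_polyX map_polyC /=.
by rewrite !mxE eqxx.
Qed.

Lemma rank_diag (F : fieldType) n (d : 'rV[F]_n) :
  \rank (diag_mx d) = (\sum_(i < n) (d 0%R i != 0%R))%N.
Proof.
elim: n d => [|n IH] d; first by rewrite big_ord0 flatmx0 mxrank0.
have [a [d' ->]] : exists a d', d = row_mx a%:M d' :> 'rV_(1 + n).
  exists (d 0 0), (@rsubmx _ 1 1 n d); rewrite -[LHS](@hsubmxK _ 1 1 n).
  congr row_mx; rewrite [LHS]mx11_scalar !mxE.
  by congr (d _ _)%:M; apply: val_inj.
rewrite -[n.+1]/(1 + n)%N diag_mx_row rank_diag_block_mx IH big_split_ord big_ord1.
congr addn.
  rewrite [diag_mx _]mx11_scalar -scalemx1.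
  rewrite row_mxEl !mxE eqxx !mulr1n; have [->|a0] := eqVneq a 0.
    by rewrite scale0r mxrank0.
  by rewrite mxrank_scale_nz ?mxrank1.
by apply: eq_bigr => i _; rewrite row_mxEr.
Qed.

Lemma spectral_decompN n (A : 'M[R]_n) P d :
  spectral_decomp A P d -> spectral_decomp (- A) P (- d).
Proof.
by case=> uP eA; split=> //; rewrite !map_mxN eA linearN /= mulmxN mulNmx.
Qed.

(** The same [P] diagonalizes [A] and [- A], with [d] and [- d]; a nonzero entry is negative in
    exactly one of them. *)
Lemma ind_add_indN n (A : 'M[R]_n) :
  A^T = A -> (ind A + ind (- A))%N = \rank A.
Proof.
move=> /symmetric_spectral[P [d dA]].
rewrite (ind_spectral dA) (ind_spectral (spectral_decompN dA)) -big_split /=.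
case: dA => uP eA; rewrite -(mxrank_map toC) eA.
rewrite mxrankMfree ?row_free_unit ?unitarymx_unit //.
rewrite eqmxMfull ?row_full_unit ?unitarymx_unit ?trmxC_unitary // rank_diag.
apply: eq_bigr => i _; rewrite !mxE oppr_lt0 fmorph_eq0.
by case: ltgtP.
Qed.

Lemma diag_formE n (d : 'rV[R]_n) (v : 'rV[R[i]]_n) :
  (v *m diag_mx (map_mx toC d) *m v^t*) 0 0
    = \sum_(i < n) toC (d 0 i) * `|v 0 i| ^+ 2.
Proof.
rewrite mul_mx_diag mxE; apply: eq_bigr => i _.
by rewrite !mxE normCK mulrAC mulrC mulrA.
Qed.

(** Its diagonal matrix projects onto the negative coordinates, which turns counts of signs into
    ranks. *)
Definition neg_support n (d : 'rV[R]_n) : 'rV[R[i]]_n :=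
  \row_i ((d 0 i < 0)%R)%:R.

Lemma rank_neg_support n (d : 'rV[R]_n) :
  \rank (diag_mx (neg_support d)) = (\sum_(i < n) (d 0 i < 0)%R)%N.
Proof.
rewrite rank_diag; apply: eq_bigr => i _; rewrite mxE.
by case: (d 0 i < 0); rewrite ?oner_eq0 ?eqxx.
Qed.

(* If it failed, some nonzero vector in the negative space of [S^T *m A *m S]
   would be sent by [S] into the nonnegative spectral space of [A]. *)
Lemma ind_congr_le m n (A : 'M[R]_n) (S : 'M[R]_(n, m)) :
  A^T = A -> (ind (S^T *m A *m S) <= ind A)%N.
Proof.
move=> sA; have [P [d dA]] := symmetric_spectral sA.
have sB : (S^T *m A *m S)^T = S^T *m A *m S.
  exact: tr_congr.
have [V [e dB]] := symmetric_spectral sB.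
rewrite (ind_spectral dA) (ind_spectral dB) -!rank_neg_support.
case: dA dB => uP eA [uV eB].
(* [Z] is [S^T] written in the two eigenbases. *)
pose Z := V *m map_mx toC S^T *m P^t*.
have eZ : diag_mx (map_mx toC e) = Z *m diag_mx (map_mx toC d) *m Z^t*.
  rewrite /Z !trmx_mul !map_mxM /= trmxCK conj_toC trmxK.
  have := congr1 (fun M => V *m M *m V^t*) eB.
  rewrite !map_mxM /= eA !mulmxA (unitarymxP uV) mul1mx.
  by rewrite -(mulmxA (diag_mx _)) (unitarymxP uV) mulmx1 => ->.
rewrite leqNgt; apply/negP => lt_rank.
set E := diag_mx (neg_support e) in lt_rank.
set F := diag_mx (neg_support d) in lt_rank.
(* The image of the row space of [E] under [Z *m F] has dimension at most [\rank F < \rank E]. *)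
have : \rank (E :&: kermx (Z *m F))%MS != 0.
  apply/eqP => K0; have := mxrank_mul_ker E (Z *m F).
  rewrite K0 addn0 => rE; move: lt_rank; rewrite -rE ltnNge mulmxA.
  by rewrite mxrankM_maxr.
rewrite mxrank_eq0 => /rowV0Pn[v]; rewrite sub_capmx => /andP[/submxP[w ew]].
move=> /sub_kermxP; rewrite mulmxA => vZF v0.
have v_off i : 0 <= e 0 i -> v 0 i = 0.
  by rewrite ew mul_mx_diag !mxE ltNge => ->; rewrite mulr0.
have vZ_off i : d 0 i < 0 -> (v *m Z) 0 i = 0.
  move/rowP: vZF => /(_ i); rewrite mul_mx_diag !mxE => vZF di.
  by move: vZF; rewrite di mulr1.
have ge0 : 0 <= (v *m diag_mx (map_mx toC e) *m v^t*) 0 0.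
  have -> : v *m diag_mx (map_mx toC e) *m v^t*
      = (v *m Z) *m diag_mx (map_mx toC d) *m (v *m Z)^t*.
    by rewrite trmx_mul map_mxM eZ !mulmxA.
  rewrite diag_formE.
  apply: sumr_ge0 => i _; have [di|di] := leP 0 (d 0 i).
    by rewrite mulr_ge0 ?exprn_ge0 ?normr_ge0 // ler0c.
  by rewrite vZ_off // normr0 expr0n mulr0.
(* In the coordinates of [e] the same value is negative, since [v] is nonzero and supported where
   [e] is negative. *)
move: ge0; rewrite diag_formE; have /rV0Pn[i vi] := v0.
rewrite (bigD1 i) //= => ge0.
have ei : e 0 i < 0.
  by rewrite ltNge; apply/negP => /v_off vi0; rewrite vi0 eqxx in vi.
have : toC (e 0 i) * `|v 0 i| ^+ 2 < 0.
  by rewrite nmulr_rlt0 ?exprn_gt0 ?normr_gt0 // ltcR.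
rewrite -(ltrD2r (\sum_(j < m | j != i) toC (e 0 j) * `|v 0 j| ^+ 2)).
rewrite add0r => /(le_lt_trans ge0)/lt_geF/negbT/negP; apply.
apply: sumr_le0 => j _; have [ej|ej] := leP 0 (e 0 j).
  by rewrite v_off // normr0 expr0n mulr0.
by rewrite mulr_le0_ge0 ?exprn_ge0 ?normr_ge0 // lecR ltW.
Qed.
End Inertia.

(** * Orthogonal projection onto a kernel *)

Section KernelProjection.
Variable R : realFieldType.

Definition kerproj m n (A : 'M[R]_(m, n)) : 'M[R]_n := 1%:M - mpinv A *m A.

Lemma mulmx_kerproj m n (A : 'M[R]_(m, n)) : A *m kerproj A = 0.
Proof.
have /and4P[/eqP h _ _ _] := mpinvP A.
by rewrite mulmxBr mulmx1 mulmxA h subrr.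
Qed.

Lemma tr_kerproj m n (A : 'M[R]_(m, n)) : (kerproj A)^T = kerproj A.
Proof.
have /and4P[_ _ _ /eqP h] := mpinvP A.
by rewrite linearB /= trmx1 h.
Qed.

Lemma kerproj_tr m n (A : 'M[R]_(m, n)) : kerproj A *m A^T = 0.
Proof. by rewrite -tr_kerproj -trmx_mul mulmx_kerproj trmx0. Qed.

Lemma kerproj_id m n p (A : 'M[R]_(m, n)) (B : 'M[R]_(n, p)) :
  A *m B = 0 -> kerproj A *m B = B.
Proof. by move=> AB; rewrite mulmxBl mul1mx -mulmxA AB mulmx0 subr0. Qed.

(** On row vectors [kerproj A] annihilates exactly the row space of [A], which lies in [W]; the
    formula is rank-nullity on [W]. *)
Lemma mxrank_add_kerproj m n p (A : 'M[R]_(m, n)) (W : 'M[R]_(p, n)) :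
  (A <= W)%MS -> \rank W = (\rank A + \rank (W *m kerproj A))%N.
Proof.
move=> AW; rewrite -(mxrank_mul_ker W (kerproj A)) addnC; congr addn.
apply/eqP; rewrite eqn_leq !mxrankS //.
  by rewrite sub_capmx AW; apply/sub_kermxP/mulmx_kerproj.
apply/row_subP => i.
have /submx_trans : (row i (W :&: kermx (kerproj A)) <= kermx (kerproj A))%MS.
  exact: submx_trans (row_sub _ _) (capmxSr _ _).
apply; apply/rV_subP => v /sub_kermxP; rewrite mulmxBr mulmx1 mulmxA.
by move/eqP; rewrite subr_eq0 => /eqP ->; apply: submxMl.
Qed.

Lemma mxrank_kerproj m n (A : 'M[R]_(m, n)) :
  \rank (kerproj A) = (n - \rank A)%N.
Proof.
have /mxrank_add_kerproj := submx1 A.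
rewrite mul1mx mxrank1 => /(congr1 (subn^~ (\rank A))).
by rewrite /= addKn => ->.
Qed.
End KernelProjection.

(* The congruence between ciP Y Z and - ciP Z Y; locked because
   [rewrite mulmxA] would otherwise unfold it. *)
HB.lock Definition ciS (R : realType) n (Y Z : 'M[R]_(n + n, n)) : 'M[R]_n :=
  mpinv (usubmx Y) *m usubmx Z *m ciT Y Z.

(** * The comparative index under exchange of two frames *)

Section ComparativeIndexPair.
Variables (R : realType) (n : nat).
Implicit Types Y Z : 'M[R]_(n + n, n).

Lemma wronskianE Y Z :
  wronskian Y Z = (usubmx Y)^T *m dsubmx Z - (dsubmx Y)^T *m usubmx Z.
Proof.
rewrite /wronskian /sympJ -{1}[Y]vsubmxK -{1}[Z]vsubmxK tr_col_mx.
rewrite mul_row_block mul_row_col !mulmx0 add0r addr0 mulmx1 mulmxN mulmx1.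
by rewrite mulNmx addrC.
Qed.

Lemma wronskian_swap Y Z : wronskian Z Y = - (wronskian Y Z)^T.
Proof. by rewrite !wronskianE linearB /= !trmx_mul !trmxK opprB. Qed.

Lemma frame_sym Y :
  frame Y -> (usubmx Y)^T *m dsubmx Y = (dsubmx Y)^T *m usubmx Y.
Proof. by case=> /eqP; rewrite wronskianE subr_eq0 => /eqP. Qed.

(* The subspace spanned by a frame is maximal isotropic, so that
   [dsubmx Y] maps [ker (usubmx Y)] onto the orthogonal of [Im (usubmx Y)]. *)
Lemma frame_range p Y (B : 'M[R]_(n, p)) (X := usubmx Y) :
  frame Y -> kerproj X *m (dsubmx Y)^T *m B = 0 -> X *m mpinv X *m B = B.
Proof.
move=> fY KUB; pose Q := 1%:M - X *m mpinv X.
have QX : Q *m X = 0.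
  by have /and4P[/eqP h _ _ _] := mpinvP X; rewrite mulmxBl mul1mx h subrr.
have : (kerproj X *m (dsubmx Y)^T <= kermx X)%MS.
  by apply/sub_kermxP; rewrite -mulmxA -frame_sym // mulmxA kerproj_tr mul0mx.
move/mxrank_leqif_eq/geq_leqif; rewrite mxrank_ker -mxrank_kerproj.
(* [Y] has full rank and its upper block vanishes on [ker X], so its lower block is injective there.
   The inclusion above is then an equality by dimension. *)
have -> : \rank (kerproj X *m (dsubmx Y)^T) = \rank (kerproj X).
  have full : row_full Y by case: fY => _ /eqP.
  rewrite -mxrank_tr trmx_mul trmxK tr_kerproj -(eqmxMfull (kerproj X) full).
  rewrite -{2}[Y]vsubmxK mul_col_mx mulmx_kerproj -addsmxE.
  by rewrite adds0mx.
rewrite leqnn => /esym/andP[_ kerKU].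
have : (Q <= kerproj X *m (dsubmx Y)^T)%MS.
  by apply: submx_trans kerKU; apply/sub_kermxP.
case/submxP => G eQ; have : Q *m B = 0 by rewrite eQ -mulmxA KUB mulmx0.
by rewrite mulmxBl mul1mx => /eqP; rewrite subr_eq0 => /eqP.
Qed.

Lemma ciMT Y Z : ciM Y Z *m ciT Y Z = 0.
Proof. exact: mulmx_kerproj. Qed.

Lemma tr_ciT Y Z : (ciT Y Z)^T = ciT Y Z.
Proof. exact: tr_kerproj. Qed.

Lemma ciPE Y Z : ciP Y Z = ciT Y Z *m (wronskian Y Z)^T *m ciS Y Z.
Proof. by rewrite /ciP ciS.unlock !mulmxA. Qed.

Lemma tr_ciPE Y Z : (ciP Y Z)^T = (ciS Y Z)^T *m wronskian Y Z *m ciT Y Z.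
Proof. by rewrite ciPE trmx_mul (trmx_mul (ciT Y Z)) trmxK tr_ciT mulmxA. Qed.

Lemma ciME Y Z :
  ciM Y Z = - (kerproj (usubmx Y) *m (dsubmx Y)^T *m usubmx Z).
Proof.
by rewrite /ciM wronskianE mulmxBr mulmxA kerproj_tr mul0mx sub0r mulmxA.
Qed.

(** As [ciM Y Z *m ciT Y Z = 0], the columns of [usubmx Z *m ciT Y Z] lie in the range of
    [usubmx Y], and [ciS] lifts them through it. *)
Lemma mul_usubmx_ciS Y Z :
  frame Y -> usubmx Y *m ciS Y Z = usubmx Z *m ciT Y Z.
Proof.
move=> fY; rewrite ciS.unlock !mulmxA -mulmxA; apply: (frame_range fY).
by apply/eqP; rewrite mulmxA -oppr_eq0 -mulNmx -ciME ciMT.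
Qed.

(** On the common vectors [usubmx Y *m ciS Y Z = usubmx Z *m ciT Y Z], the form is the difference of
    those of [Z] and [Y], each symmetric by isotropy. *)
Lemma ciP_sym Y Z : frame Y -> frame Z -> (ciP Y Z)^T = ciP Y Z.
Proof.
move=> fY fZ; suff e : (ciP Y Z)^T =
    (ciT Y Z)^T *m ((usubmx Z)^T *m dsubmx Z) *m ciT Y Z
    - (ciS Y Z)^T *m ((dsubmx Y)^T *m usubmx Y) *m ciS Y Z.
  rewrite -[RHS]trmxK e; move: (ciT Y Z) (ciS Y Z) => T S.
  rewrite linearB /= !tr_congr //.
    by rewrite trmx_mul trmxK frame_sym.
  by rewrite trmx_mul trmxK frame_sym.
rewrite tr_ciPE wronskianE; move: (mul_usubmx_ciS Z fY).
move: (ciT Y Z) (ciS Y Z) => T S XS.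
by rewrite mulmxBr mulmxBl !mulmxA -trmx_mul XS trmx_mul -!mulmxA XS.
Qed.

(** By the lifting identity and the isotropy of [Z], both terms of the Wronskian start with
    [(usubmx Z)^T], which the projection annihilates. So [ciS Y Z] takes its values in
    [ker (ciM Z Y)]. *)
Lemma ker_ciS Y Z : frame Y -> frame Z ->
  kerproj (usubmx Z) *m (wronskian Y Z)^T *m ciS Y Z = 0.
Proof.
move=> fY fZ; rewrite -[_^T]opprK -wronskian_swap wronskianE.
move: (mul_usubmx_ciS Z fY) (frame_sym fZ) (kerproj_tr (usubmx Z)).
move: (ciT Y Z) (ciS Y Z) (kerproj _) => T S K XS sZ KX.
rewrite opprB mulmxBr [X in _ - X]mulmxA KX mul0mx subr0 -!mulmxA XS.
by rewrite (mulmxA _^T) -sZ !mulmxA KX !mul0mx.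
Qed.

Lemma ciT_ciS Y Z : frame Y -> frame Z -> ciT Z Y *m ciS Y Z = ciS Y Z.
Proof.
move=> fY fZ; apply: kerproj_id; rewrite /ciM wronskian_swap mulmxN mulNmx.
by rewrite ker_ciS // oppr0.
Qed.

(** Lifting through one upper block and then the other gives back the original vector up to
    [ker (usubmx Z)]. *)
Lemma mul_ciS Y Z : frame Y -> frame Z ->
  ciS Z Y *m ciS Y Z = ciT Y Z - kerproj (usubmx Z) *m ciT Y Z.
Proof.
move=> fY fZ; have -> : ciS Z Y = mpinv (usubmx Z) *m usubmx Y *m ciT Z Y.
  by rewrite ciS.unlock.
move: (ciT_ciS fY fZ) (mul_usubmx_ciS Z fY).
rewrite /kerproj; move: (ciT Y Z) (ciS Y Z) (ciT Z Y) => T S T' TS XS.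
by rewrite -(mulmxA _ T' S) TS -(mulmxA _ _ S) XS mulmxBl mul1mx subKr mulmxA.
Qed.

(** The error term of [mul_ciS] is invisible to the form, by the transpose of [ker_ciS]. *)
Lemma ciP_congr Y Z : frame Y -> frame Z ->
  ciP Y Z = (ciS Y Z)^T *m (- ciP Z Y) *m ciS Y Z.
Proof.
move=> fY fZ; rewrite -[LHS]ciP_sym // tr_ciPE ciPE (wronskian_swap Y Z).
move: (ciT_ciS fY fZ) (mul_ciS fY fZ) (ker_ciS fY fZ).
move: (tr_kerproj (usubmx Z)) (tr_ciT Z Y).
move: (kerproj _) (ciT Z Y) (ciS Z Y) (ciT Y Z) (ciS Y Z) (wronskian Y Z).
move=> K T' S' T S W sK sT' T'S S'S KWS.
have SWK : S^T *m W *m K = 0.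
  by apply: trmx_inj; rewrite !trmx_mul trmxK sK mulmxA KWS trmx0.
rewrite [(- _)^T]linearN /= trmxK !(mulmxN, mulNmx) opprK !mulmxA -sT' -trmx_mul T'S.
by rewrite -[RHS]mulmxA S'S mulmxBr !mulmxA SWK mul0mx subr0.
Qed.

Lemma ind_ciP_swap Y Z : frame Y -> frame Z -> ind (ciP Z Y) = ind (- ciP Y Z).
Proof.
move=> fY fZ; have sym A : A^T = A -> (- A)^T = - A :> 'M[R]_n.
  by move=> sA; rewrite linearN /= sA.
apply/eqP; rewrite eqn_leq {1}(ciP_congr fZ fY) ind_congr_le ?sym ?ciP_sym //.
rewrite (ciP_congr fY fZ) -[X in ind X]mulNmx -mulmxN opprK ind_congr_le //.
exact: ciP_sym.
Qed.

(** The left-hand matrix and [(ciP Y Z)^T] are left multiples of each other, through [(ciS Y Z)^T]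
    and [(ciS Z Y)^T]. *)
Lemma rank_ciP Y Z : frame Y -> frame Z ->
  \rank (ciT Z Y *m wronskian Y Z *m ciT Y Z) = \rank (ciP Y Z).
Proof.
move=> fY fZ; rewrite -(mxrank_tr (ciP Y Z)) tr_ciPE.
have KWT : kerproj (usubmx Y) *m wronskian Y Z *m ciT Y Z = 0 by exact: ciMT.
move: KWT (ciT_ciS fY fZ) (mul_ciS fZ fY) (tr_kerproj (usubmx Y)) (tr_ciT Z Y).
move: (kerproj _) (ciT Z Y) (ciS Z Y) (ciT Y Z) (ciS Y Z) (wronskian Y Z).
move=> K T' S' T S W KWT T'S SS' sK sT'.
have e1 : S^T *m W *m T = S^T *m (T' *m W *m T).
  by rewrite -{1}T'S trmx_mul sT' !mulmxA.
have e2 : T' *m W *m T = S'^T *m (S^T *m W *m T).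
  rewrite !mulmxA -trmx_mul SS' linearB /= trmx_mul sT' sK !mulmxBl.
  have -> : T' *m K *m W *m T = 0 by rewrite -!mulmxA (mulmxA K) KWT mulmx0.
  by rewrite subr0.
by apply/eqP; rewrite eqn_leq {1}e2 mxrankM_maxr e1 mxrankM_maxr.
Qed.

Lemma rank_wronskian Y Z : frame Y -> frame Z ->
  \rank (wronskian Y Z) =
    (\rank (ciM Y Z) + \rank (ciM Z Y) + \rank (ciP Y Z))%N.
Proof.
move=> fY fZ; have := submxMl (kerproj (usubmx Y)) (wronskian Y Z).
move=> /mxrank_add_kerproj ->.
rewrite -addnA; congr addn; rewrite -mxrank_tr trmx_mul tr_kerproj.
(* [ciM Y Z] factors through [usubmx Z], so [ciT Y Z] fixes [ker (usubmx Z)]; hence the second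
   splitting, done on the transpose, is still by a subspace. *)
have KT : kerproj (usubmx Z) *m ciT Y Z = kerproj (usubmx Z).
  rewrite -[LHS]trmxK trmx_mul tr_ciT tr_kerproj kerproj_id ?tr_kerproj //.
  by rewrite ciME mulNmx -(mulmxA _ (usubmx Z)) mulmx_kerproj mulmx0 oppr0.
have sub : (ciM Z Y <= ciT Y Z *m (wronskian Y Z)^T)%MS.
  rewrite /ciM wronskian_swap mulmxN -/(kerproj (usubmx Z)) -KT -mulmxA -mulNmx.
  exact: submxMl.
rewrite (mxrank_add_kerproj sub) -rank_ciP //; congr addn.
rewrite -[kerproj (ciM Z Y)]/(ciT Z Y) -[LHS]mxrank_tr.
move: (tr_ciT Y Z) (tr_ciT Z Y); move: (ciT Y Z) (ciT Z Y) (wronskian Y Z).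
by move=> T T' W sT sT'; rewrite !trmx_mul trmxK sT sT' mulmxA.
Qed.

Lemma mu_sgn_swap e Y Z : frame Y -> frame Z ->
  (mu_sgn e Y Z + mu_sgn e Z Y)%N = \rank (wronskian Y Z).
Proof.
move=> fY fZ; rewrite rank_wronskian // -(ind_add_indN (ciP_sym fY fZ)).
have := ind_ciP_swap fZ fY; have := ind_ciP_swap fY fZ.
case: e; rewrite /mu_sgn /mu /mu_star.
  by move=> -> _; rewrite addnACA.
by move=> _ <-; rewrite addnACA (addnC (ind (ciP Y Z))).
Qed.
End ComparativeIndexPair.

(** * Sums over consecutive entries of lists and segments *)

Section PathSum.
Variables (V : nmodType) (U : zmodType) (g : V -> V -> U).
Implicit Types s : seq V.

(** The part shared by [mu_c] and [nu_c], which differ only in the closing term. *)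
Definition path_sum s : U := \sum_(0 <= k < (size s).-1) g s`_k s`_k.+1.

Lemma path_sum_cons x s :
  (0 < size s)%N -> path_sum (x :: s) = g x s`_0 + path_sum s.
Proof. by case: s => // y s _; rewrite /path_sum /= big_nat_recl. Qed.

Lemma path_sum_rcons s x : (0 < size s)%N ->
  path_sum (rcons s x) = path_sum s + g s`_(size s).-1 x.
Proof.
case: (lastP s) => // {}s y _; rewrite /path_sum !size_rcons /= big_nat_recr //=.
congr (_ + g _ _); last by rewrite nth_rcons size_rcons ltnn eqxx.
  apply: eq_big_nat => k /andP[_ ks].
  by rewrite !(nth_rcons _ (rcons s y)) !size_rcons !ltnS ks ltnW.
by rewrite nth_rcons size_rcons ltnS leqnn.
Qed.
End PathSum.

Section Segment.
Variables (V : nmodType) (Y : nat -> V) (a b : nat).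
Hypothesis le_ab : (a <= b)%N.

Lemma size_segment : size (segment Y a b) = (b - a).+1.
Proof. by rewrite size_map size_iota subSn. Qed.

Lemma nth_segment k : (k <= b - a)%N -> (segment Y a b)`_k = Y (a + k)%N.
Proof.
move=> kb; rewrite (nth_map 0%N) ?size_iota ?subSn //.
by rewrite nth_iota ?subSn.
Qed.

Lemma path_sum_segment (U : zmodType) (g : V -> V -> U) :
  path_sum g (segment Y a b) = \sum_(a <= k < b) g (Y k) (Y k.+1).
Proof.
rewrite /path_sum size_segment /= -[in RHS](add0n a) big_addn.
apply: eq_big_nat => k /andP[_ kb].
by rewrite !nth_segment ?(ltnW kb) // addnS addnC.
Qed.
End Segment.

(** * Cyclic sums of segments, possibly with one extra frame *)

Section CyclicSums.
Variables (R : realType) (n : nat) (e : csign).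
Implicit Types (Y : nat -> 'M[R]_(n + n, n)) (Z : 'M[R]_(n + n, n)).
Implicit Types s : seq 'M[R]_(n + n, n).
Local Notation f Y Z := (mu_sgn e Y Z)%:Z.
Let g (Y Z : 'M[R]_(n + n, n)) : int := (mu_sgn e Y Z)%:Z.

Lemma mu_cE s : mu_c e s = path_sum g s + g s`_(size s).-1 s`_0.
Proof. by []. Qed.

Lemma nu_cE s : nu_c e s = path_sum g s - g s`_0 s`_(size s).-1.
Proof. by []. Qed.

Lemma path_sum2 Z1 Z2 : path_sum g [:: Z1; Z2] = g Z1 Z2.
Proof. by rewrite /path_sum big_nat1. Qed.

Lemma path_sum3 Z1 Z2 Z3 : path_sum g [:: Z1; Z2; Z3] = g Z1 Z2 + g Z2 Z3.
Proof. by rewrite path_sum_cons // path_sum2. Qed.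

Lemma cyclic_segment Y a b : (a <= b)%N ->
  nu_c e (segment Y a b) = \sum_(a <= k < b) f (Y k) (Y k.+1) - f (Y a) (Y b) /\
  mu_c e (segment Y a b) = \sum_(a <= k < b) f (Y k) (Y k.+1) + f (Y b) (Y a).
Proof.
move=> ab; rewrite nu_cE mu_cE path_sum_segment // size_segment //=.
by rewrite !nth_segment // addn0 subnKC.
Qed.

Lemma cyclic_cons Z Y a b : (a <= b)%N ->
  nu_c e (Z :: segment Y a b) =
    f Z (Y a) + \sum_(a <= k < b) f (Y k) (Y k.+1) - f Z (Y b) /\
  mu_c e (Z :: segment Y a b) =
    f Z (Y a) + \sum_(a <= k < b) f (Y k) (Y k.+1) + f (Y b) Z.
Proof.
move=> ab; rewrite nu_cE mu_cE path_sum_cons ?size_segment //.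
rewrite path_sum_segment //.
by rewrite /= size_segment //= !nth_segment // addn0 subnKC.
Qed.

Lemma cyclic_rcons Z Y a b : (a <= b)%N ->
  nu_c e (rcons (segment Y a b) Z) =
    \sum_(a <= k < b) f (Y k) (Y k.+1) + f (Y b) Z - f (Y a) Z /\
  mu_c e (rcons (segment Y a b) Z) =
    \sum_(a <= k < b) f (Y k) (Y k.+1) + f (Y b) Z + f Z (Y a).
Proof.
move=> ab; rewrite nu_cE mu_cE path_sum_rcons ?size_segment //.
rewrite path_sum_segment //.
rewrite size_rcons /= !nth_rcons size_segment //= ltnn eqxx.
by rewrite !nth_segment // addn0 subnKC.
Qed.

Lemma nu_c3 Z1 Z2 Z3 : nu_c e [:: Z1; Z2; Z3] = f Z1 Z2 + f Z2 Z3 - f Z1 Z3.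
Proof. by rewrite nu_cE path_sum3. Qed.

Lemma mu_c3 Z1 Z2 Z3 : mu_c e [:: Z1; Z2; Z3] = f Z1 Z2 + f Z2 Z3 + f Z3 Z1.
Proof. by rewrite mu_cE path_sum3. Qed.
End CyclicSums.

Theorem proposition2p8 (R : realType) (n m : nat)
    (Y : nat -> 'M[R]_(n + n, n)) (hm : (3 <= m)%N)
    (hY : forall k : nat, (1 <= k <= m)%N -> frame (Y k)) (e : csign) :
  (* (i) *)
  [/\ forall l : nat, (2 <= l < m)%N ->
        nu_c e (segment Y 1 m)
          = nu_c e (segment Y 1 l) + nu_c e (Y 1%N :: segment Y l m)
        /\ nu_c e (segment Y 1 m)
          = nu_c e (rcons (segment Y 1 l) (Y m)) + nu_c e (segment Y l m),
      forall i j : nat, (1 <= i <= m)%N -> (1 <= j <= m)%N ->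
        nu_c e [:: Y i; Y j] = 0,
      nu_c e (segment Y 1 m)
        = \sum_(2 <= j < m) nu_c e [:: Y 1%N; Y j; Y j.+1]
    & nu_c e (segment Y 1 m)
        = \sum_(1 <= j < m.-1) nu_c e [:: Y j; Y j.+1; Y m] ]
  /\
  (* (ii) *)
  [/\ forall l : nat, (2 <= l < m)%N ->
        mu_c e (segment Y 1 m)
          = mu_c e (segment Y 1 l) + mu_c e (Y 1%N :: segment Y l m)
            - (\rank (wronskian (Y 1%N) (Y l)))%:Z
        /\ mu_c e (segment Y 1 m)
          = mu_c e (rcons (segment Y 1 l) (Y m)) + mu_c e (segment Y l m)
            - (\rank (wronskian (Y l) (Y m)))%:Z,
      forall i j : nat, (1 <= i <= m)%N -> (1 <= j <= m)%N ->
        mu_c e [:: Y i; Y j] = (\rank (wronskian (Y i) (Y j)))%:Z,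
      mu_c e (segment Y 1 m)
        = \sum_(2 <= j < m) mu_c e [:: Y 1%N; Y j; Y j.+1]
          - \sum_(3 <= j < m) (\rank (wronskian (Y 1%N) (Y j)))%:Z
    & mu_c e (segment Y 1 m)
        = \sum_(1 <= j < m.-1) mu_c e [:: Y j; Y j.+1; Y m]
          - \sum_(2 <= j < m.-1) (\rank (wronskian (Y j) (Y m)))%:Z ].
Proof.
pose f i j : int := (mu_sgn e (Y i) (Y j))%:Z.
pose S a b := \sum_(a <= k < b) f k k.+1.
have rk i j : (1 <= i <= m)%N -> (1 <= j <= m)%N ->
    (\rank (wronskian (Y i) (Y j)))%:Z = f i j + f j i.
  by move=> hi hj; rewrite -(mu_sgn_swap e) ?PoszD //; apply: hY.
have m2 : (2 <= m)%N by apply: leq_trans hm.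
have m1 := ltnW m2.
have [nu1m mu1m] := cyclic_segment e Y m1.
have Scat l : (2 <= l < m)%N -> S 1%N m = S 1%N l + S l m.
  case/andP=> l2 lm.
  by rewrite /S (big_cat_nat_idem _ (n := l)) ?(ltnW lm) ?(ltnW l2).
split; split.
- move=> l hl; have /andP[/ltnW l1 /ltnW lm] := hl; rewrite nu1m.
  rewrite (cyclic_segment e Y l1).1 (cyclic_segment e Y lm).1.
  rewrite (cyclic_cons e _ Y lm).1 (cyclic_rcons e _ Y l1).1.
  by rewrite -/(S 1%N m) (Scat l hl) /S; split; ring.
- by move=> i j _ _; rewrite nu_cE path_sum2 subrr.
(* The differences telescope to [f 1 m - f 1 2], whose last term restores the missing edge from 1 to
   2. *)
- have -> : \sum_(2 <= j < m) nu_c e [:: Y 1%N; Y j; Y j.+1]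
      = \sum_(2 <= j < m) (f j j.+1 - (f 1%N j.+1 - f 1%N j)).
    by apply: eq_bigr => j _; rewrite nu_c3 /f; ring.
  by rewrite nu1m big_ltn // sumrB telescope_sumr // /f; ring.
(* Here the upper end of the telescoping sum supplies the last edge, from [m.-1] to [m]. *)
- have -> : \sum_(1 <= j < m.-1) nu_c e [:: Y j; Y j.+1; Y m]
      = \sum_(1 <= j < m.-1) (f j j.+1 + (f j.+1 m - f j m)).
    by apply: eq_bigr => j _; rewrite nu_c3 /f; ring.
  rewrite nu1m big_split /=; case: (m) m2 => // m' m2'.
  by rewrite big_nat_recr //= (telescope_sumr (fun j => f j m'.+1)) // /f; ring.
(* Cutting along a chord adds it once in each direction, and the rank is the sum of these two
   terms. *)
- move=> l hl; have /andP[/ltnW l1 /ltnW lm] := hl; rewrite mu1m.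
  rewrite (cyclic_segment e Y l1).2 (cyclic_segment e Y lm).2.
  rewrite (cyclic_cons e _ Y lm).2 (cyclic_rcons e _ Y l1).2.
  rewrite !rk ?l1 ?lm ?m1 ?leqnn // -/(S 1%N m) (Scat l hl) /S /f.
  by split; ring.
- by move=> i j hi hj; rewrite mu_cE path_sum2 rk.
(* The ranks cancel both directions of the chords from 1 to [j] with [3 <= j < m]; the edges [f 1 2]
   and [f m 1] remain. *)
- rewrite mu1m big_ltn //; under [X in _ - X]eq_big_nat => j /andP[j3 jm].
    rewrite rk ?leqnn ?m1 ?(ltnW jm) ?(leq_trans _ j3) //; over.
  under [X in X - _]eq_bigr do rewrite mu_c3.
  rewrite !big_split /= [X in X + _ + _ - _]big_ltn //.
  have -> : \sum_(2 <= j < m) f j.+1 1%N = \sum_(3 <= j < m) f j 1%N + f m 1%N.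
    by rewrite -big_nat_recr // [RHS]big_add1.
  by rewrite /f; ring.
(* Likewise for the chords ending at [m]: after the index shift, [f m.-1 m] and [f m 1] remain. *)
- have -> : \sum_(2 <= j < m.-1) (\rank (wronskian (Y j) (Y m)))%:Z
      = \sum_(2 <= j < m.-1) (f j m + f m j).
    apply: eq_big_nat => j /andP[j2 jm]; rewrite rk ?m1 ?leqnn // (ltnW j2).
    exact: leq_trans (ltnW jm) (leq_pred m).
  have -> : \sum_(1 <= j < m.-1) mu_c e [:: Y j; Y j.+1; Y m]
      = \sum_(1 <= j < m.-1) (f j j.+1 + f j.+1 m + f m j).
    by apply: eq_bigr => j _; rewrite mu_c3.
  rewrite mu1m; case: (m) hm => [|m'] //= hm'.
  have -> : \sum_(1 <= k < m'.+1) f k k.+1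
      = \sum_(1 <= k < m') f k k.+1 + f m' m'.+1.
    by rewrite big_nat_recr // ltnW.
  have shift : \sum_(1 <= j < m') f j.+1 m'.+1
      = \sum_(2 <= j < m') f j m'.+1 + f m' m'.+1.
    by rewrite -big_nat_recr // [RHS]big_add1.
  rewrite !big_split /= shift [X in _ + _ + X - _]big_ltn // /f; ring.
Qed.
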